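(* Let $1<p\le 2$. Then every gentle-narrow bounded linear operator $T:L_p\to L_p$ is narrow.
   Context: All spaces are real. $L_p$ denotes $L_p[0,1]$ with Lebesgue measure $\mu$, $\|\cdot\|$ on $L_p$ is the $L_p$-norm, $\Sigma$ is the $\sigma$-algebra of Lebesgue measurable subsets of $[0,1]$, and for $A\in\Sigma$, $L_p(A)=\{x\in L_p:\operatorname{supp}x\subseteq A\}$. Narrow: for a Banach space $X$, a bounded linear operator $T:L_p\to X$ is narrow if for every $\varepsilon>0$ and every $A\in\Sigma$ there exists $x\in L_p$ with $x^2=\mathbf 1_A$ (a.e.), $\int_{[0,1]}x\,d\mu=0$ and $\|Tx\|<\varepsilon$. Truncation: for a measurable function $x$ on $[0,1]$ and $M>0$, the $M$-truncation $x^M$ is defined by $x^M(t)=x(t)$ if $|x(t)|\le M$ and $x^M(t)=M\cdot\operatorname{sign}(x(t))$ if $|x(t)|>M$. $p$-gentle function: for $1<p\le2$, a decreasing (i.e. non-increasing) function $\varphi:(0,+\infty)\to[0,1]$ is $p$-gentle if $\lim_{M\to+\infty}M^{2-p}(\varphi(M))^p=0$. Gentle-narrow: for $1<p\le 2$ and a Banach space $X$, a bounded linear operator $T:L_p\to X$ is gentle-narrow if there exists a $p$-gentle function $\varphi:(0,+\infty)\to[0,1]$ such that for every $\varepsilon>0$, every $M>0$ and every $A\in\Sigma$ there exists $x\in L_p(A)$ with (i) $\|x\|=\mu(A)^{1/p}$; (ii) $\|x-x^M\|\le\varphi(M)\,\mu(A)^{1/p}$; (iii) $\|Tx\|\le\varepsilon$.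 *)

(* Defs.v *)
From HB Require Import structures.
From mathcomp Require Import all_boot all_order all_algebra.
From mathcomp Require Import ring_quotient.
From mathcomp Require Import all_classical all_reals all_analysis.
From mathcomp Require Import measurable_realfun ess_sup_inf.

Set Implicit Arguments.
Unset Strict Implicit.
Unset Printing Implicit Defensive.
Import Order.TTheory GRing.Theory Num.Theory.
Import numFieldNormedType.Exports.

Local Open Scope classical_set_scope.
Local Open Scope ring_scope.

(* The normed space L_p(mu): p-integrable functions ([LfunType]) modulo *)
(* almost everywhere equality.  The library's [LspaceType] carries no vector *)
(* space structure. *)
Section Lp_space.
Context d (T : measurableType d) (R : realType).
Variables (mu : {measure set T -> \bar R}) (p : \bar R) (p1 : (1 <= p)%E).

Definition null_Lfun : {pred LfunType mu p1} :=
  fun f => `[< f = cst 0 %[ae mu] >].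

Lemma null_Lfun_zmod_closed : zmod_closed null_Lfun.
Proof.
split; first exact/asboolP/nearW.
move=> f g /asboolP f0 /asboolP g0; apply/asboolP.
apply: filterS2 f0 g0 => t /= f0 g0 _.
by rewrite -[LHS]/(f t - g t) f0// g0// subr0.
Qed.

HB.instance Definition _ :=
  GRing.isZmodClosed.Build (LfunType mu p1) null_Lfun null_Lfun_zmod_closed.

Definition Lp : Type := Quotient.quot null_Lfun.

HB.instance Definition _ := GRing.Zmodule.on Lp.
HB.instance Definition _ := EqQuotient.on Lp.

Definition Lp_class (f : LfunType mu p1) : Lp := \pi_Lp%qT f.

(* An arbitrary representative of the class; only almost everywhere *)
(* properties of it are meaningful. *)
Definition Lp_repr (x : Lp) : LfunType mu p1 := repr x.
Definition Lp_fun (x : Lp) : T -> R := Lp_repr x.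

Lemma Lp_reprK : cancel Lp_repr Lp_class.
Proof. exact: reprK. Qed.

Lemma Lp_classP (f g : LfunType mu p1) :
  Lp_class f = Lp_class g <-> f = g %[ae mu].
Proof.
split=> [/eqP|fg].
  rewrite -Quotient.idealrBE => /asboolP; apply: filterS => t /= + _.
  by move=> /(_ Logic.I)/eqP; rewrite -[X in X == _]/(f t - g t) subr_eq0 => /eqP.
apply/eqP; rewrite -Quotient.idealrBE; apply/asboolP.
by apply: filterS fg => t /= fg _; rewrite -[LHS]/(f t - g t) fg// subrr.
Qed.

Lemma Lp_class_reprE (f : LfunType mu p1) : Lp_repr (Lp_class f) = f %[ae mu].
Proof. by apply/Lp_classP; rewrite Lp_reprK. Qed.

Lemma Lp_classD (f g : LfunType mu p1) :
  Lp_class (f + g) = Lp_class f + Lp_class g.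
Proof. exact: (raddfD \pi_(Quotient.quot null_Lfun)%qT). Qed.

Definition Lp_scale (a : R) (x : Lp) : Lp := Lp_class (a *: Lp_repr x).

Lemma Lp_classZ (a : R) (f : LfunType mu p1) :
  Lp_class (a *: f) = Lp_scale a (Lp_class f).
Proof.
apply/Lp_classP; apply: filterS (Lp_class_reprE f) => t /= ft _.
by rewrite -[LHS]/(a * f t) -[RHS]/(a * Lp_repr (Lp_class f) t) ft.
Qed.

Lemma Lp_scaleA a b x : Lp_scale a (Lp_scale b x) = Lp_scale (a * b) x.
Proof. by rewrite -(Lp_reprK x) -!Lp_classZ scalerA. Qed.

Lemma Lp_scale1 : left_id 1 Lp_scale.
Proof. by move=> x; rewrite /Lp_scale scale1r Lp_reprK. Qed.

Lemma Lp_scaleDr : right_distributive Lp_scale +%R.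
Proof.
move=> a x y; rewrite -(Lp_reprK x) -(Lp_reprK y).
by rewrite -Lp_classD -!Lp_classZ scalerDr Lp_classD.
Qed.

Lemma Lp_scaleDl x : {morph Lp_scale^~ x : a b / a + b}.
Proof.
by move=> a b; rewrite -(Lp_reprK x) -!Lp_classZ scalerDl Lp_classD.
Qed.

HB.instance Definition _ :=
  GRing.Zmodule_isLmodule.Build R Lp Lp_scaleA Lp_scale1 Lp_scaleDr Lp_scaleDl.

Definition Lp_norm (x : Lp) : R := fine ('N[mu]_p[EFin \o Lp_fun x])%E.

Lemma ae_eq_Lnorm (f g : LfunType mu p1) : f = g %[ae mu] ->
  'N[mu]_p[EFin \o f]%E = 'N[mu]_p[EFin \o g]%E.
Proof.
rewrite unlock; case: p p1 f g => [r r1 f g fg|y1 f g fg|//].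
- congr (_ `^ _)%E; apply: ge0_ae_eq_integral => //.
  + apply/measurable_EFinP; apply: (measurableT_comp (measurable_powR _)) => //.
    exact: measurableT_comp.
  + apply/measurable_EFinP; apply: (measurableT_comp (measurable_powR _)) => //.
    exact: measurableT_comp.
  + by move=> t _; exact: poweR_ge0.
  + by move=> t _; exact: poweR_ge0.
  + by apply: filterS fg => t /= + _; move=> /(_ Logic.I) ->.
- case: ifPn => // _; apply: eq_ess_sup.
  by apply: filterS fg => t /= /(_ Logic.I) ->.
Qed.

Lemma Lp_normE (f : LfunType mu p1) :
  Lp_norm (Lp_class f) = fine ('N[mu]_p[EFin \o f])%E.
Proof.
by congr fine; exact/ae_eq_Lnorm/Lp_class_reprE. Qed.

Lemma ler_Lp_normD x y : Lp_norm (x + y) <= Lp_norm x + Lp_norm y.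
Proof.
rewrite -(Lp_reprK x) -(Lp_reprK y) -Lp_classD !Lp_normE.
exact: ler_LnormD.
Qed.

Lemma Lp_normZ a x : Lp_norm (a *: x) = `|a| * Lp_norm x.
Proof.
rewrite Lp_normE -[x in RHS]Lp_reprK Lp_normE.
by rewrite [X in fine X](LnormZ (Lp_repr x) a) -finite_norm_fine -EFinM.
Qed.

Lemma Lp_norm0_eq0 x : Lp_norm x = 0 -> x = 0.
Proof.
move=> /fine_Lnormr_eq0 x0; rewrite -(Lp_reprK x).
suff <- : Lp_class 0 = 0 by exact/Lp_classP.
exact: (raddf0 \pi_(Quotient.quot null_Lfun)%qT).
Qed.

HB.instance Definition _ :=
  Lmodule_isNormed.Build R Lp ler_Lp_normD Lp_normZ Lp_norm0_eq0.

Lemma Lp_normEfin (x : Lp) : `|x| = fine ('N[mu]_p[EFin \o Lp_fun x])%E.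
Proof. by []. Qed.

End Lp_space.

(* The real line with its Lebesgue measurable sets, the domain of the *)
(* library's [completed_lebesgue_measure]. *)
Definition lebesgueType (R : realType) :=
  caratheodory_type (((@wlength R idfun)^*)%mu).

Section unit_interval.
Context {R : realType}.

Lemma lebesgue_measurable_unit_itv :
  measurable (`[0, 1]%classic : set (lebesgueType R)).
Proof.
apply: sub_caratheodory.
have : measurable (`[0, 1]%classic : set (measurableTypeR R)) by [].
exact.
Qed.

(* [0, 1] is modelled by the line with Lebesgue measure restricted to it, so *)
(* that values outside [0, 1] are irrelevant. *)
Definition unit_lebesgue : set (lebesgueType R) -> \bar R :=
  mrestr (@completed_lebesgue_measure R) lebesgue_measurable_unit_itv.

HB.instance Definition _ := Measure.on unit_lebesgue.

End unit_interval.

Lemma ge1_EFin (R : realType) (p : R) : 1 < p -> (1 <= p%:E)%E.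
Proof. by move=> p1; rewrite lee_fin ltW. Qed.

(* L_p[0, 1] for 1 < p < +oo. *)
Notation Lp01 hp := (Lp (@unit_lebesgue _) (ge1_EFin hp)).

Definition bounded_operator (R : realType) (X Y : normedModType R)
    (f : X -> Y) : Prop :=
  exists C : R, forall x, `|f x| <= C * `|x|.

(* Lebesgue measurable subset of [0, 1]. *)
Definition unit_measurable (R : realType) (A : set (lebesgueType R)) : Prop :=
  measurable A /\ A `<=` `[0, 1].

Definition truncation (R : realType) (T : Type) (M : R) (x : T -> R) : T -> R :=
  fun t => if `|x t| <= M then x t else M * Num.sg (x t).

(* Only the values of phi on ]0, +oo[ matter. *)
Definition gentle (R : realType) (p : R) (phi : R -> R) : Prop :=
  [/\ forall M : R, 0 < M -> 0 <= phi M <= 1,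
      forall M N : R, 0 < M -> M <= N -> phi N <= phi M &
      M `^ (2 - p) * phi M `^ p @[M --> +oo] --> (0 : R)].

Section narrow_operators.
Context (R : realType) (p : R) (hp : 1 < p) (X : normedModType R).
Local Notation mu := (@unit_lebesgue R).

Definition narrow (T : Lp01 hp -> X) : Prop :=
  forall (e : R) (A : set (lebesgueType R)), 0 < e -> unit_measurable A ->
  exists x : Lp01 hp,
    [/\ \forall t \ae mu, Lp_fun x t ^+ 2 = \1_A t,
        (\int[mu]_t (Lp_fun x t)%:E = 0)%E &
        `|T x| < e].

Definition supported_in (A : set (lebesgueType R)) (x : Lp01 hp) : Prop :=
  \forall t \ae mu, ~ A t -> Lp_fun x t = 0.

Definition gentle_narrow (T : Lp01 hp -> X) : Prop :=
  exists2 phi : R -> R, gentle p phi &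
  forall (e M : R) (A : set (lebesgueType R)),
  0 < e -> 0 < M -> unit_measurable A ->
  exists x : Lp01 hp,
    [/\ supported_in A x,
        `|x| = fine (mu A) `^ p^-1,
        ('N[mu]_p%:E[EFin \o (Lp_fun x \- truncation M (Lp_fun x))%R]
           <= (phi M * fine (mu A) `^ p^-1)%:E)%E &
        `|T x| <= e].

End narrow_operators.

(* Main.v *)
Require Import Defs.
From mathcomp Require Import all_boot all_order all_algebra.
From mathcomp Require Import all_classical all_reals all_analysis.
From mathcomp Require Import ring lra measurable_realfun.

(** Let S be a gentle-narrow operator on L_p and A a measurable subset of
    [0, 1]. For a large constant K consider the energy
      E(x) = int x^2 - K (|S x|^p + (int x)^2)
    on the functions x with |x| <= 1_A. It is bounded above there by the
    measure of A, and E(0) = 0, so K (|S x|^p + (int x)^2) is at most 2 for a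
    near-maximiser x: both |S x| and the integral of x are small. The point is
    that |x| is close to 1 on most of A; then replacing x by its sign, and
    switching that sign on a small set to make the integral vanish, changes
    S x only a little and gives the function required by narrowness.

    Suppose |x| <= 1 - delta on a subset B of A of positive measure. For p <= 2 the
    p-th power of the norm of L_p satisfies half of the parallelogram
    identity (lemma [Lp_norm_parallelogram_le]), the two quadratic terms
    satisfy all of it, and therefore
      E(x + z) + E(x - z) >= 2 E(x) + 2 E(z).
    Hence if |z| <= delta 1_B and E(z) >= c mu(B), one of x + z and x - z is
    an admissible function of energy at least E(x) + c mu(B), which a
    near-maximiser forbids (lemma [near_maximizer]).

    Gentleness provides z (lemma [gentle_gain]). Take y supported in B, with
    |y| = mu(B)^(1/p) and S y almost 0, and put z = (delta / M) y^M. The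
    square of the L_2-norm of z is at least of order (delta / M)^2 mu(B), while
    |S z|^p is at most of order (delta / M)^p phi(M)^p mu(B); the quotient of
    the second by the first is at most of order
    delta^(p - 2) M^(2 - p) phi(M)^p, which tends to 0 as M grows, for fixed
    delta. The term (int z)^2 is at most delta^2 mu(B)^2, negligible as soon as
    mu(B) is small, and Lebesgue measure having no atoms B may be shrunk
    (lemma [unit_lebesgue_divisible]). *)

Set Implicit Arguments.
Unset Strict Implicit.
Unset Printing Implicit Defensive.
Import Order.TTheory GRing.Theory Num.Theory.
Import numFieldNormedType.Exports.
Local Open Scope ring_scope.
Local Open Scope classical_set_scope.

(** * Integrals and almost everywhere comparison *)

Section ae_Rintegral.
Context d (T : measurableType d) (R : realType).
Context (mu : {measure set T -> \bar R}).

Lemma ae_eq_Rintegral (f g : T -> R) :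
  measurable_fun setT f -> measurable_fun setT g ->
  (\forall t \ae mu, f t = g t) -> \int[mu]_t f t = \int[mu]_t g t.
Proof.
move=> mf mg fg; congr fine; apply: ae_eq_integral => //.
- exact/measurable_EFinP.
- exact/measurable_EFinP.
- by apply: filterS fg => t /= ->.
Qed.

Lemma ae_le_Rintegral (f g : T -> R) :
  mu.-integrable setT (EFin \o f) -> mu.-integrable setT (EFin \o g) ->
  (\forall t \ae mu, f t <= g t) -> \int[mu]_t f t <= \int[mu]_t g t.
Proof.
move=> fi gi fg; rewrite -subr_ge0 -RintegralB//.
have mf : measurable_fun setT f by apply/measurable_EFinP; exact: measurable_int fi.
have mg : measurable_fun setT g by apply/measurable_EFinP; exact: measurable_int gi.
have mgf : measurable_fun setT (fun t => g t - f t) by exact: measurable_funB.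
rewrite (@ae_eq_Rintegral _ (fun t => `|g t - f t|))//.
- by apply: Rintegral_ge0.
- exact: measurableT_comp.
- by apply: filterS fg => t ft; rewrite ger0_norm// subr_ge0.
Qed.

Context (muoo : (mu setT < +oo)%E).

Lemma bounded_ae_integrable (f : T -> R) (c : R) :
  measurable_fun setT f -> (\forall t \ae mu, `|f t| <= c) ->
  mu.-integrable setT (EFin \o f).
Proof.
move=> mf fc; apply/integrableP; split; first exact/measurable_EFinP.
apply: (@le_lt_trans _ _ (\int[mu]_t (`|c|%:E))%E).
  apply: ae_ge0_le_integral => //.
  - by apply: measurableT_comp => //; exact/measurable_EFinP.
  - by apply: filterS fc => t fc _; rewrite lee_fin (le_trans fc)// ler_norm.
by rewrite integral_cst// lte_mul_pinfty// lee_fin.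
Qed.

Lemma integrable_indicZ (A : set T) (c : R) : measurable A ->
  mu.-integrable setT (EFin \o (fun t => c * \1_A t)).
Proof.
move=> mA; apply: (@bounded_ae_integrable _ `|c|).
  by apply: measurable_funM.
apply: aeW => t; rewrite normrM ler_piMr// indicE.
by case: (t \in A); rewrite ?normr1 ?normr0.
Qed.

Lemma Rintegral_indicZ (A : set T) (c : R) : measurable A ->
  \int[mu]_t (c * \1_A t) = c * fine (mu A).
Proof.
move=> mA; rewrite RintegralZl//; last first.
  have := integrable_indicZ 1 mA.
  by under [X in _.-integrable _ (_ \o X)]eq_fun do rewrite mul1r.
by congr (c * fine _); rewrite integral_indic// setIT.
Qed.

End ae_Rintegral.

(** * Elements of L_p through their representatives *)

Section Lp_facts.
Context d (T : measurableType d) (R : realType).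
Context (mu : {measure set T -> \bar R}) (p : R) (p1 : (1 <= p%:E)%E).
Local Notation L := (Lp mu p1).
Implicit Types u v : L.

Lemma measurable_Lp_fun u : measurable_fun setT (Lp_fun u).
Proof. exact: measurable_funPT. Qed.

Lemma Lp_funD u v : \forall t \ae mu, Lp_fun (u + v) t = Lp_fun u t + Lp_fun v t.
Proof.
have -> : u + v = Lp_class (p1 := p1) (Lp_repr u + Lp_repr v) by rewrite Lp_classD !Lp_reprK.
by apply: filterS (Lp_class_reprE (Lp_repr u + Lp_repr v)) => t /(_ Logic.I).
Qed.

Lemma Lp_funZ a u : \forall t \ae mu, Lp_fun (a *: u) t = a * Lp_fun u t.
Proof. by apply: filterS (Lp_class_reprE (a *: Lp_repr u)) => t /(_ Logic.I). Qed.

Lemma Lp_funN u : \forall t \ae mu, Lp_fun (- u) t = - Lp_fun u t.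
Proof.
by rewrite -scaleN1r; apply: filterS (Lp_funZ (-1) u) => t ->; rewrite mulN1r.
Qed.

Lemma Lp_funB u v : \forall t \ae mu, Lp_fun (u - v) t = Lp_fun u t - Lp_fun v t.
Proof. by apply: filterS2 (Lp_funD u (- v)) (Lp_funN v) => t -> ->. Qed.

Let p_gt0 : 0 < p.
Proof. by rewrite (lt_le_trans ltr01)// -lee_fin. Qed.

Lemma Lp_fun_powR_integrable u :
  mu.-integrable setT (EFin \o (fun t => `|Lp_fun u t| `^ p)).
Proof. apply: Lfun_integrable; [by rewrite -lee_fin | exact: LfunP]. Qed.

Lemma Lp_norm_powR u : `|u| `^ p = \int[mu]_t (`|Lp_fun u t| `^ p).
Proof.
rewrite Lp_normEfin /Rintegral unlock/=.
rewrite -fine_poweR -poweRrM mulVf ?gt_eqF// poweRe1//.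
by apply: integral_ge0 => t _; rewrite lee_fin powR_ge0.
Qed.

Lemma Lp_of_powR_integrable (f : T -> R) : measurable_fun setT f ->
  mu.-integrable setT (EFin \o (fun t => `|f t| `^ p)) ->
  exists u, \forall t \ae mu, Lp_fun u t = f t.
Proof.
move=> mf /integrableP[_ foo].
have fL : f \in Lfun mu p%:E.
  rewrite inE; apply/andP; split; rewrite inE//= /finite_norm unlock.
  apply: poweR_lty; apply: le_lt_trans foo.
  by under [leRHS]eq_integral do
    rewrite /= ger0_norm ?powR_ge0// -poweR_EFin.
exists (Lp_class (Lfun_Sub p1 fL)).
by apply: filterS (Lp_class_reprE (Lfun_Sub p1 fL)) => t /(_ Logic.I); rewrite Lfun_valP.
Qed.

Lemma Lp_of_bounded (muoo : (mu setT < +oo)%E) (f : T -> R) c :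
  measurable_fun setT f -> (forall t, `|f t| <= c) ->
  exists u, \forall t \ae mu, Lp_fun u t = f t.
Proof.
move=> mf fc; apply: Lp_of_powR_integrable => //.
apply: (@bounded_ae_integrable _ _ _ _ muoo _ (c `^ p)).
  by apply: (measurableT_comp (measurable_powR _)) => //; exact: measurableT_comp.
apply: aeW => t; rewrite ger0_norm ?powR_ge0//.
have c0 : 0 <= c by exact: le_trans (fc t).
by apply: ge0_ler_powR (fc t); rewrite ?nnegrE// ltW.
Qed.

Lemma Lp_norm_le_Lnorm u (f : T -> R) (r : R) : measurable_fun setT f ->
  (\forall t \ae mu, Lp_fun u t = f t) ->
  ('N[mu]_p%:E[EFin \o f] <= r%:E)%E -> `|u| <= r.
Proof.
move=> mf uf fr; rewrite Lp_normEfin.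
suff -> : 'N[mu]_p%:E[EFin \o Lp_fun u]%E = 'N[mu]_p%:E[EFin \o f]%E.
  have N0 := Lnorm_ge0 mu p%:E (EFin \o f).
  rewrite -lee_fin fineK// ge0_fin_numE//; exact: le_lt_trans fr (ltry _).
have mpow (g : T -> R) : measurable_fun setT g ->
    measurable_fun setT (fun t => `|(EFin \o g) t|%E `^ p)%E.
  move=> mg; apply/measurable_EFinP.
  by apply: (measurableT_comp (measurable_powR _)) => //; exact: measurableT_comp.
rewrite unlock; apply: (congr1 (fun x => x `^ p^-1)%E); apply: ae_eq_integral => //.
- by apply: mpow; exact: measurable_Lp_fun.
- exact: mpow.
- by apply: filterS uf => t /= ->.
Qed.

End Lp_facts.

(** * Powers, and the parallelogram inequality in L_p *)

Section powR_inequalities.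
Context (R : realType).
Implicit Types a b p q : R.

Lemma powR_mono p a b : 0 <= p -> 0 <= a -> a <= b ->
  a `^ p <= b `^ p.
Proof. by move=> p0 a0 ab; rewrite ge0_ler_powR ?nnegrE//; exact: le_trans ab. Qed.

Lemma powR_mono_inv p a b : 0 < p -> 0 <= a -> 0 <= b ->
  a `^ p <= b `^ p -> a <= b.
Proof.
move=> p0 a0 b0; rewrite leNgt => h; rewrite leNgt; apply: contra h => ba.
by rewrite gt0_ltr_powR ?nnegrE.
Qed.

(** After division by a + b both arguments lie in [0, 1], where a power of
    exponent at most 1 dominates the identity. *)
Lemma powR_subadditive q a b : q <= 1 -> 0 <= a -> 0 <= b ->
  (a + b) `^ q <= a `^ q + b `^ q.
Proof.
move=> q1; rewrite le_eqVlt => /predU1P[<- _|a0].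
  by rewrite add0r lerDr powR_ge0.
rewrite le_eqVlt => /predU1P[<-|b0].
  by rewrite addr0 lerDl powR_ge0.
have s0 : 0 < a + b by rewrite addr_gt0.
have le_part c : 0 < c -> c <= a + b -> c / (a + b) * (a + b) `^ q <= c `^ q.
  move=> c0 cs; have c1 : 0 < c / (a + b) <= 1.
    by rewrite divr_gt0//= ler_pdivrMr// mul1r.
  rewrite -{2}(divfK (lt0r_neq0 s0) c) powRM ?(ltW s0) ?(ltW (proj1 (andP c1)))//.
  by rewrite ler_pM2r ?powR_gt0// ger1_powR.
have := lerD (le_part a a0 _) (le_part b b0 _).
rewrite -mulrDl -mulrDl divff ?lt0r_neq0// mul1r; apply; lra.
Qed.

(** Convexity of the inverse power, applied to the two powers. *)
Lemma powR_midpoint_concave q a b : 0 < q <= 1 -> 0 <= a -> 0 <= b ->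
  a `^ q + b `^ q <= 2 * ((a + b) / 2) `^ q.
Proof.
move=> /andP[q0 q1] a0 b0.
have q1' : 1 <= q^-1 by rewrite invf_ge1.
have half01 : (0 <= 2^-1 :> R) && (2^-1 <= 1 :> R) by apply/andP; split; lra.
pose t : {i01 R} := Itv01 (proj1 (andP half01)) (proj2 (andP half01)).
have := @convex_powR R _ q1' t (a `^ q) (b `^ q).
rewrite !inE/= !in_itv/= !powR_ge0 => /(_ isT isT).
rewrite [X in X `^ _ <= _]convRE convRE/= -!powRrM divff ?gt_eqF// !powRr1//.
rewrite (_ : unstable.onem 2^-1 = 2^-1 :> R); last by rewrite /unstable.onem; field.
rewrite -!mulrDr => h.
have s0 : 0 <= 2^-1 * (a `^ q + b `^ q) by rewrite mulr_ge0// addr_ge0// powR_ge0.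
have := @ge0_ler_powR _ _ (ltW q0) _ _ _ _ h.
rewrite !nnegrE powR_ge0 mulr_ge0 ?addr_ge0// => /(_ isT isT).
rewrite -powRrM mulVf ?gt_eqF// powRr1// ler_pdivrMl// mulrC.
by rewrite [2^-1 * _]mulrC mulrC.
Qed.

(** Take the power p / 2 in the parallelogram identity: it is concave on the
    left-hand side and subadditive on the right-hand side. *)
Lemma powR_parallelogram_le p a b : 0 < p <= 2 ->
  `|a + b| `^ p + `|a - b| `^ p <= 2 * (`|a| `^ p + `|b| `^ p).
Proof.
move=> /andP[p0 p2].
have sqE c : `|c| `^ p = (c ^+ 2) `^ (p / 2).
  by rewrite -real_normK ?num_real// -powR_mulrn// -powRrM mulrC divfK// pnatr_eq0.
rewrite !sqE; apply: (le_trans (powR_midpoint_concave _ _ _)); rewrite ?sqr_ge0//; first lra.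
rewrite ler_pM2l// (_ : _ / 2 = a ^+ 2 + b ^+ 2); last by field.
by apply: powR_subadditive; rewrite ?sqr_ge0//; lra.
Qed.

(** Splitting according to whether a is below s or not, this bounds a
    p-th power from above by a square, up to a small constant: it turns a lower
    bound on an L_p-norm into one on an L_2-norm. *)
Lemma powR_le_sqr p a s : 0 <= p <= 2 -> 0 < s -> 0 <= a ->
  a `^ p <= s `^ p + s `^ (p - 2) * a ^+ 2.
Proof.
move=> /andP[p0 p2] s0 a0; have [as_|sa] := leP a s.
  apply: (le_trans (powR_mono p0 a0 as_)).
  by rewrite lerDl mulr_ge0 ?powR_ge0 ?sqr_ge0.
have a0' : 0 < a by exact: lt_trans sa.
have -> : a `^ p = a `^ (p - 2) * a ^+ 2.
  rewrite -powR_mulrn// -powRD; first by rewrite subrK.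
  by rewrite (gt_eqF a0') implybT.
rewrite ler_wpDl ?powR_ge0// ler_wpM2r ?sqr_ge0// -[p - 2]opprB !powRN.
rewrite lef_pV2 ?posrE ?powR_gt0//.
by apply: powR_mono; rewrite ?subr_ge0// ltW.
Qed.

End powR_inequalities.

(** The case of two vectors of type p with constant 1: the average of
    |x + y|^p and |x - y|^p is at most the sum of |x|^p and |y|^p. *)
Definition power_parallelogram (R : realType) (p : R) (X : normedModType R) : Prop :=
  forall x y : X, `|x + y| `^ p + `|x - y| `^ p <= 2 * (`|x| `^ p + `|y| `^ p).

Section Lp_parallelogram.
Context d (T : measurableType d) (R : realType).
Context (mu : {measure set T -> \bar R}) (p : R) (p1 : (1 <= p%:E)%E) (p2 : p <= 2).
Local Notation L := (Lp mu p1).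

Lemma Lp_norm_parallelogram_le : power_parallelogram p L.
Proof.
move=> u v.
have p0 : 0 < p by rewrite (lt_le_trans ltr01)// -lee_fin.
pose f w t := `|Lp_fun (w : L) t| `^ p.
have fi w : mu.-integrable setT (EFin \o f w) by exact: Lp_fun_powR_integrable.
have fD w z : mu.-integrable setT (EFin \o (fun t => f w t + f z t)).
  exact: (integrableD measurableT (fi w) (fi z)).
have nE w : `|w| `^ p = \int[mu]_t f w t by exact: Lp_norm_powR.
rewrite !nE -(RintegralD measurableT (fi (u + v)) (fi (u - v))).
rewrite -(RintegralD measurableT (fi u) (fi v)) -(RintegralZl 2 measurableT (fD u v)).
apply: ae_le_Rintegral => //; first exact: (integrableZl measurableT 2 (fD u v)).
apply: filterS2 (Lp_funD u v) (Lp_funB u v) => t uDv uBv.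
rewrite /f uDv uBv.
by rewrite powR_parallelogram_le// p0.
Qed.

End Lp_parallelogram.

(** * Lebesgue measure on the unit interval *)

(** Absence of atoms in the form given by Sierpinski's theorem: below a
    measurable set all intermediate values of the measure are attained. *)
Definition divisible d (T : measurableType d) (R : realType)
    (mu : {measure set T -> \bar R}) : Prop :=
  forall (A : set T) (r : R), measurable A -> 0 <= r <= fine (mu A) ->
  exists B, [/\ measurable B, B `<=` A & mu B = r%:E].

Section unit_lebesgue_facts.
Context (R : realType).
Local Notation mu := (@unit_lebesgue R).
Implicit Types A B : set (lebesgueType R).

Lemma measurable_lebesgue_itv (i : interval R) :
  measurable ([set` i] : set (lebesgueType R)).
Proof.
apply: sub_caratheodory.
have : measurable ([set` i] : set (measurableTypeR R)) by [].
exact.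
Qed.

Lemma completed_lebesgue_measure_itv (i : interval R) :
  completed_lebesgue_measure ([set` i] : set (lebesgueType R)) =
  (if i.1 < i.2 then (i.2 : \bar R) - i.1 else 0)%E.
Proof. by rewrite -lebesgue_measure_itv. Qed.

Lemma unit_lebesgueT : mu setT = 1%E.
Proof.
rewrite -[LHS]/(completed_lebesgue_measure _) setTI.
by rewrite completed_lebesgue_measure_itv/= lte01 oppr0 adde0.
Qed.

Lemma unit_lebesgue_le1 A : measurable A -> (mu A <= 1)%E.
Proof. by move=> mA; rewrite -unit_lebesgueT le_measure ?inE. Qed.

Lemma unit_lebesgue_fin_num A : measurable A -> mu A \is a fin_num.
Proof.
by move=> mA; rewrite ge0_fin_numE// (le_lt_trans (unit_lebesgue_le1 mA))// ltry.
Qed.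

Lemma unit_lebesgue_itv_le (s t : R) : s <= t -> (mu `]s, t]%classic <= (t - s)%:E)%E.
Proof.
move=> st; rewrite -[leLHS]/(completed_lebesgue_measure _).
apply: (@le_trans _ _ (completed_lebesgue_measure (`]s, t]%classic : set (lebesgueType R)))).
  apply: le_measure; rewrite ?inE.
  - by apply: measurableI; exact: measurable_lebesgue_itv.
  - exact: measurable_lebesgue_itv.
  - exact: subIsetl.
rewrite completed_lebesgue_measure_itv/= lte_fin; case: ifPn => // _.
by rewrite lee_fin subr_ge0.
Qed.

(** The measure of the part of A below t is a 1-Lipschitz function of t, to
    which the intermediate value theorem applies. *)
Lemma unit_lebesgue_divisible : divisible mu.
Proof.
move=> A r mA /andP[r0 rA].
pose F (t : R) : set (lebesgueType R) := A `&` `]-oo, t]%classic.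
have mF t : measurable (F t).
  by apply: measurableI => //; exact: measurable_lebesgue_itv.
pose g t := fine (mu (F t)).
have gE t : mu (F t) = (g t)%:E by rewrite fineK// unit_lebesgue_fin_num.
have gD s t : s <= t -> 0 <= g t - g s <= t - s.
  move=> st.
  have Fst : F t = F s `|` (A `&` `]s, t]%classic).
    rewrite /F -setIUr; congr (_ `&` _); apply/seteqP; split => x /=; rewrite !in_itv/=.
      by move=> xt; have [xs|sx] := leP x s; [left|right].
    by case=> [xs|/andP[]//]; exact: le_trans xs st.
  have mst : measurable (A `&` `]s, t]%classic).
    by apply: measurableI => //; exact: measurable_lebesgue_itv.
  have FtE : mu (F t) = (mu (F s) + mu (A `&` `]s, t]%classic))%E.
    rewrite [in LHS]Fst measureU//.
    apply/seteqP; split => // x [[_ /=]]; rewrite in_itv/= => xs [_ /=].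
    by rewrite in_itv/= ltNge xs.
  have le1 : (mu (A `&` `]s, t]%classic) <= (t - s)%:E)%E.
    apply: le_trans (unit_lebesgue_itv_le st).
    by apply: le_measure; rewrite ?inE//; exact: measurable_lebesgue_itv.
  have ge0 : (0 <= mu (A `&` `]s, t]%classic))%E by exact: measure_ge0.
  move: FtE le1 ge0; rewrite -(fineK (unit_lebesgue_fin_num mst)) !gE -EFinD.
  by rewrite !lee_fin => -[->] h1 h0; rewrite addrAC subrr add0r h0.
have gc : continuous g.
  move=> t; apply/cvgrPdist_le => /= e e0; near=> s.
  have ts : `|t - s| <= e by near: s; exact: cvgr_dist_le.
  apply: le_trans ts; have [st|/ltW st] := leP s t.
    by have /andP[h0 h1] := gD _ _ st; rewrite ger0_norm// (le_trans h1)// ler_norm.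
  have /andP[h0 h1] := gD _ _ st.
  by rewrite distrC ger0_norm// (le_trans h1)// distrC ler_norm.
have g0 : g (-1) = 0.
  rewrite /g -[mu _]/(completed_lebesgue_measure _).
  suff -> : F (-1) `&` `[0, 1]%classic = set0 by rewrite measure0.
  apply/seteqP; split => // x [[_ /=]]; rewrite !in_itv/= => x1 /andP[x0 _].
  by have := le_trans x0 x1; rewrite lerNr oppr0 ler10.
have g1 : g 1 = fine (mu A).
  rewrite /g -[mu (F 1)]/(completed_lebesgue_measure _).
  suff -> : F 1 `&` `[0, 1]%classic = A `&` `[0, 1]%classic by [].
  rewrite /F -setIA; congr (_ `&` _).
  by apply/seteqP; split => x /=; rewrite !in_itv/=; [case | move=> /andP[-> ->]].
have [//||t _ gt] := @IVT R g (-1) 1 r _ (continuous_subspaceT gc).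
  by rewrite g0 g1 ge_min le_max r0 rA orbT.
exists (F t); split => //; first exact: subIsetl.
by rewrite -gt; exact: gE.
Unshelve. all: by end_near. Qed.

End unit_lebesgue_facts.

(** * The energy functional *)

(** For p < 2 an element of L_p need not be square integrable; this condition
    makes the quadratic part of the energy below finite. *)
Definition ebounded d (T : measurableType d) (R : realType)
    (mu : {measure set T -> \bar R}) (f : T -> R) : Prop :=
  exists c : R, \forall t \ae mu, `|f t| <= c.

Section energy.
Context d (T : measurableType d) (R : realType).
Context (mu : {measure set T -> \bar R}) (p : R) (p1 : (1 <= p%:E)%E).
Local Notation L := (Lp mu p1).
Implicit Types u v : L.

Definition Lp_int u : R := \int[mu]_t Lp_fun u t.
Definition Lp_sqr u : R := \int[mu]_t (Lp_fun u t ^+ 2).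

Context (X : normedModType R) (K : R) (S : {linear L -> X}).

Definition energy u : R := Lp_sqr u - K * (`|S u| `^ p + Lp_int u ^+ 2).

Context (muoo : (mu setT < +oo)%E).

Lemma Lp_fun_integrable u : ebounded mu (Lp_fun u) ->
  mu.-integrable setT (EFin \o Lp_fun u).
Proof. by move=> [c uc]; apply: bounded_ae_integrable uc => //; exact: measurable_Lp_fun. Qed.

Lemma measurable_Lp_sqr u : measurable_fun setT (fun t => Lp_fun u t ^+ 2).
Proof. by apply: measurable_funX; exact: measurable_Lp_fun. Qed.

Lemma Lp_sqr_integrable u : ebounded mu (Lp_fun u) ->
  mu.-integrable setT (EFin \o (fun t => Lp_fun u t ^+ 2)).
Proof.
move=> [c uc]; apply: (@bounded_ae_integrable _ _ _ _ muoo _ (c ^+ 2)).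
  exact: measurable_Lp_sqr.
apply: filterS uc => t uc; rewrite normrX ler_pXn2r ?nnegrE//.
exact: le_trans uc.
Qed.

Lemma ebounded_Lp_funD u v : ebounded mu (Lp_fun u) -> ebounded mu (Lp_fun v) ->
  ebounded mu (Lp_fun (u + v)).
Proof.
move=> [a ua] [b vb]; exists (a + b).
apply: filterS3 (Lp_funD u v) ua vb => t -> ua vb.
by rewrite (le_trans (ler_normD _ _))// lerD.
Qed.

Lemma ebounded_Lp_funN u : ebounded mu (Lp_fun u) -> ebounded mu (Lp_fun (- u)).
Proof.
by move=> [a ua]; exists a; apply: filterS2 (Lp_funN u) ua => t ->; rewrite normrN.
Qed.

Lemma Lp_intD u v : ebounded mu (Lp_fun u) -> ebounded mu (Lp_fun v) ->
  Lp_int (u + v) = Lp_int u + Lp_int v.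
Proof.
move=> ub vb; rewrite /Lp_int -RintegralD//; [|exact: Lp_fun_integrable..].
apply: ae_eq_Rintegral (Lp_funD u v); first exact: measurable_Lp_fun.
by apply: measurable_funD; exact: measurable_Lp_fun.
Qed.

Lemma Lp_intZ a u : ebounded mu (Lp_fun u) -> Lp_int (a *: u) = a * Lp_int u.
Proof.
move=> ub; rewrite /Lp_int -RintegralZl//; last exact: Lp_fun_integrable.
apply: ae_eq_Rintegral (Lp_funZ a u); first exact: measurable_Lp_fun.
by apply: measurable_funM => //; exact: measurable_Lp_fun.
Qed.

Lemma Lp_intB u v : ebounded mu (Lp_fun u) -> ebounded mu (Lp_fun v) ->
  Lp_int (u - v) = Lp_int u - Lp_int v.
Proof.
move=> ub vb; rewrite Lp_intD//; last exact: ebounded_Lp_funN.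
by rewrite -scaleN1r Lp_intZ// mulN1r.
Qed.

Lemma Lp_sqrZ a u : ebounded mu (Lp_fun u) ->
  Lp_sqr (a *: u) = a ^+ 2 * Lp_sqr u.
Proof.
move=> ub; rewrite /Lp_sqr -RintegralZl//; last exact: Lp_sqr_integrable.
apply: ae_eq_Rintegral; first exact: measurable_Lp_sqr.
  by apply: measurable_funM => //; exact: measurable_Lp_sqr.
by apply: filterS (Lp_funZ a u) => t ->; rewrite exprMn.
Qed.

Lemma Lp_sqr_parallelogram u v :
  ebounded mu (Lp_fun u) -> ebounded mu (Lp_fun v) ->
  Lp_sqr (u + v) + Lp_sqr (u - v) = 2 * (Lp_sqr u + Lp_sqr v).
Proof.
move=> ub vb.
have iu := Lp_sqr_integrable ub; have iv := Lp_sqr_integrable vb.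
have iD := Lp_sqr_integrable (ebounded_Lp_funD ub vb).
have iB := Lp_sqr_integrable (ebounded_Lp_funD ub (ebounded_Lp_funN vb)).
have iuv : mu.-integrable setT (EFin \o (fun t => Lp_fun u t ^+ 2 + Lp_fun v t ^+ 2)).
  exact: (integrableD measurableT iu iv).
rewrite /Lp_sqr -!RintegralD// -RintegralZl//.
apply: ae_eq_Rintegral.
- by apply: measurable_funD; exact: measurable_Lp_sqr.
- apply: measurable_funM => //.
  by apply: measurable_funD; exact: measurable_Lp_sqr.
- by apply: filterS2 (Lp_funD u v) (Lp_funB u v) => t -> ->; ring.
Qed.

(** The energy is superadditive under averaging over a sign, because its only
    non-quadratic term enters negatively and satisfies the opposite
    inequality. *)
Lemma energy_parallelogram_ge u v :
  power_parallelogram p X -> 0 <= K -> ebounded mu (Lp_fun u) -> ebounded mu (Lp_fun v) ->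
  2 * (energy u + energy v) <= energy (u + v) + energy (u - v).
Proof.
move=> typeX K0 ub vb; rewrite /energy raddfD raddfB Lp_intD// Lp_intB//.
have := Lp_sqr_parallelogram ub vb.
have := ler_wpM2l K0 (typeX (S u) (S v)).
lra.
Qed.

Implicit Types A B : set T.

Lemma ebounded_indic A c u : (\forall t \ae mu, `|Lp_fun u t| <= c * \1_A t) ->
  ebounded mu (Lp_fun u).
Proof.
move=> uA; exists `|c|; apply: filterS uA => t /le_trans; apply.
rewrite indicE; case: (t \in A); first by rewrite mulr1 ler_norm.
by rewrite mulr0.
Qed.

Lemma Lp_sqr_le_indic A c u : measurable A -> 0 <= c ->
  (\forall t \ae mu, `|Lp_fun u t| <= c * \1_A t) -> Lp_sqr u <= c ^+ 2 * fine (mu A).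
Proof.
move=> mA c0 uA; rewrite -Rintegral_indicZ//.
apply: ae_le_Rintegral; first exact/Lp_sqr_integrable/(ebounded_indic uA).
  exact: integrable_indicZ.
apply: filterS uA => t; rewrite indicE -(real_normK (num_real _)).
case: (t \in A); last first.
  by rewrite !mulr0 normr_le0 => /eqP ->; rewrite normr0 expr0n.
by rewrite !mulr1 ler_pXn2r ?nnegrE.
Qed.

(** Where an admissible x stays away from -1 and 1 there is room for a
    perturbation of positive energy, which added or subtracted raises the
    energy of x in proportion to the measure of that room. For an x whose energy
    is within min(1, c min(theta, tau)) of the supremum the room has measure
    at most tau, and the energy of x exceeds that of 0 minus 1. *)
Lemma near_maximizer A (delta tau : R) :
  power_parallelogram p X -> divisible mu ->
  (exists c theta : R, [/\ 0 < c, 0 < theta & forall B, measurable B -> B `<=` A ->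
    0 < fine (mu B) <= theta -> exists z : L,
      (\forall t \ae mu, `|Lp_fun z t| <= delta * \1_B t) /\
      c * fine (mu B) <= energy z]) ->
  measurable A -> 0 <= K -> 0 < tau ->
  exists x : L, [/\ \forall t \ae mu, `|Lp_fun x t| <= \1_A t,
    K * (`|S x| `^ p + Lp_int x ^+ 2) <= fine (mu A) + 1 &
    fine (mu (A `&` [set t | `|Lp_fun x t| <= 1 - delta])) <= tau].
Proof.
move=> typeX divmu [c [theta [c0 theta0 gain]]] mA K0 tau0.
pose D := [set x : L | \forall t \ae mu, `|Lp_fun x t| <= 1 * \1_A t].
have energy_le x : D x -> energy x <= fine (mu A).
  move=> Dx; apply: (@le_trans _ _ (Lp_sqr x)).
    by rewrite gerBl mulr_ge0// addr_ge0 ?powR_ge0 ?sqr_ge0.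
  by rewrite (le_trans (Lp_sqr_le_indic mA ler01 Dx))// expr1n mul1r.
have D0 : D 0.
  have := Lp_funZ 0 (0 : L); rewrite scale0r; apply: filterS => t ->.
  by rewrite mul0r normr0 mul1r indicE ler0n.
have E0 : energy 0 = 0.
  have e0 : ebounded mu (Lp_fun (0 : L)) by exact: ebounded_indic D0.
  have p0 : p != 0 by rewrite gt_eqF// (lt_le_trans ltr01)// -lee_fin.
  have := Lp_sqrZ 0 e0; have := Lp_intZ 0 e0; rewrite /energy scale0r raddf0.
  by move=> -> ->; rewrite normr0 powR0// expr0n !mul0r expr0n addr0 mulr0 subr0.
have supE : has_sup (energy @` D).
  split; first by exists (energy 0), 0.
  by exists (fine (mu A)) => _ [x Dx <-]; exact: energy_le.
pose r := Num.min theta tau.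
have r0 : 0 < r by rewrite lt_min theta0.
have eps0 : 0 < Num.min 1 (c * r) by rewrite lt_min ltr01 mulr_gt0.
have [_ [x Dx <-] xmax] := sup_adherent eps0 supE.
have sup0 : 0 <= sup (energy @` D).
  by rewrite -E0; apply: ub_le_sup; [exact: supE.2|exists 0].
exists x; split.
- by apply: filterS Dx => t; rewrite mul1r.
- have := Lp_sqr_le_indic mA ler01 Dx; rewrite expr1n mul1r.
  have : -1 < energy x.
    rewrite (le_lt_trans _ xmax)//.
    have : Num.min 1 (c * r) <= 1 by rewrite ge_min lexx.
    lra.
  rewrite /energy; lra.
set G := A `&` _; rewrite leNgt; apply/negP => tauG.
have mG : measurable G.
  apply: measurableI => //.
  have mx : measurable_fun setT (fun t => `|Lp_fun x t|).
    by apply: measurableT_comp => //; exact: measurable_Lp_fun.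
  have := mx measurableT `]-oo, (1 - delta)]%classic (measurable_itv _).
  by rewrite setTI; congr measurable; apply/seteqP; split => t; rewrite /= in_itv.
have [|B [mB BG muB]] := divmu G r mG.
  by rewrite ltW//= (le_trans _ (ltW tauG))// ge_min lexx orbT.
have [||z [zB zgain]] := gain B mB; first by move=> t /BG[].
  by rewrite muB/= r0 ge_min lexx.
(* x leaves a margin delta on B, and z vanishes elsewhere *)
have Dxz w : (\forall t \ae mu, `|Lp_fun w t| <= `|Lp_fun x t| + `|Lp_fun z t|) -> D w.
  move=> wxz; apply: filterS3 wxz Dx zB => t wt xt zt.
  apply: le_trans wt _; rewrite mul1r in xt *.
  have [tB|tB] := boolP (t \in B); last first.
    by move: zt; rewrite [\1_B t]indicE (negbTE tB) mulr0 => zt; lra.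
  have [tA /= tx] := BG _ (set_mem tB).
  move: zt; rewrite !indicE tB mulr1 => zt; rewrite mem_set// /=; lra.
have h w : D w -> energy w <= sup (energy @` D).
  by move=> Dw; apply: ub_le_sup; [exact: supE.2|exists w].
have hD : D (x + z).
  by apply: Dxz; apply: filterS (Lp_funD x z) => t ->; exact: ler_normD.
have hB : D (x - z).
  by apply: Dxz; apply: filterS (Lp_funB x z) => t ->; exact: ler_normB.
have := energy_parallelogram_ge typeX K0 (ebounded_indic Dx) (ebounded_indic zB).
have := h _ hD; have := h _ hB; move: zgain xmax; rewrite muB/=.
have : Num.min 1 (c * r) <= c * r by rewrite ge_min lexx orbT.
lra.
Qed.

End energy.

(** * Perturbations of positive energy *)

Section truncation.
Context (R : realType) (T : Type).
Implicit Types (M : R) (f : T -> R).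

(** This form makes the measurability of truncations evident. *)
Lemma truncationE M f : 0 <= M ->
  truncation M f = fun t => Num.max (- M) (Num.min M (f t)).
Proof.
move=> M0; apply/funext => t; rewrite /truncation ler_norml.
have [Mf|Mf] := leP (- M) (f t); have [fM|fM] := leP (f t) M; rewrite /=.
- by rewrite max_r.
- by rewrite gtr0_sg ?(le_lt_trans M0)// mulr1 max_r// (le_trans _ M0)// oppr_le0.
- by rewrite ltr0_sg ?(lt_le_trans Mf) ?oppr_le0// mulrN1 max_l// ltW.
- by have := le_lt_trans M0 (lt_trans fM Mf); rewrite oppr_gt0 ltNge M0.
Qed.

Lemma truncation_bound M f t : 0 <= M -> `|truncation M f t| <= M.
Proof.
by move=> M0; rewrite truncationE// ler_norml le_max lexx ge_max ge_min lexx/= andbT ge0_cp.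
Qed.

Lemma truncation0 M f t : 0 <= M -> f t = 0 -> truncation M f t = 0.
Proof. by move=> M0 ft; rewrite /truncation ft normr0 M0. Qed.

End truncation.

Lemma measurable_truncation d (T : measurableType d) (R : realType) (M : R)
    (f : T -> R) : 0 <= M -> measurable_fun setT f ->
  measurable_fun setT (truncation M f).
Proof.
move=> M0 mf; rewrite truncationE//.
exact: measurable_maxr (measurable_cst _) (measurable_minr (measurable_cst _) mf).
Qed.

(** Since M^(2 - p) phi(M)^p is the p-th power of M^((2 - p) / p) phi(M), a
    small multiple kappa of M^(- (2 - p) / p) can be added to a multiple of
    phi(M) at no cost. In [gentle_gain] the number kappa bounds |S y|, relative to
    the norm of y, so it has to be positive, while phi(M) may vanish. *)
Lemma gentle_choice (R : realType) (p C omega : R) (phi : R -> R) :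
  1 < p -> p <= 2 -> gentle p phi -> 0 <= C -> 0 < omega ->
  exists M kappa : R, [/\ 1 <= M, 0 < kappa, 0 <= phi M <= 2^-1 &
    M `^ (2 - p) * (kappa + C * phi M) `^ p <= omega].
Proof.
move=> p1 p2 [phi01 _ philim] C0 omega0.
have p0 : 0 < p by exact: lt_trans p1.
have C1 : 0 < 1 + C by rewrite ltr_wpDr.
pose rho := Num.min 2^-1 (Num.min 1 omega / (1 + C)).
have rho0 : 0 < rho by rewrite lt_min invr_gt0 ltr0n divr_gt0// lt_min ltr01.
have rhoC : rho * (1 + C) <= Num.min 1 omega.
  by rewrite -ler_pdivlMr// ge_min lexx orbT.
have [rhoC1 rhoCo] : rho * (1 + C) <= 1 /\ rho * (1 + C) <= omega.
  by split; rewrite (le_trans rhoC)// ge_min lexx ?orbT.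
have [M [M1 Mrho]] : exists M, 1 <= M /\ M `^ (2 - p) * phi M `^ p <= rho `^ p.
  near (pinfty_nbhs R) => M; exists M; split.
    by near: M; exact: nbhs_pinfty_ge.
  rewrite (le_trans (ler_norm _))//; near: M.
  by move: philim => /cvgr0_norm_le; apply; rewrite powR_gt0.
have M0 : 0 < M by exact: lt_le_trans M1.
have /andP[phi0 _] := phi01 M M0.
pose b := M `^ ((2 - p) / p).
have b1 : 1 <= b.
  by rewrite -[leLHS](powRr0 M) ler_powR// divr_ge0 ?subr_ge0// ltW.
have b0 : 0 < b by exact: lt_le_trans b1.
have bp : M `^ (2 - p) = b `^ p by rewrite /b -powRrM divfK ?gt_eqF.
have bphi : b * phi M <= rho.
  apply: (@powR_mono_inv _ p) => //; [by rewrite mulr_ge0// ltW|exact: ltW|].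
  by rewrite powRM ?(ltW b0)// -bp.
exists M, (rho / b); split => //.
- by rewrite divr_gt0.
- rewrite phi0 (le_trans _ (_ : rho <= 2^-1))//; last by rewrite ge_min lexx.
  by rewrite (le_trans _ bphi)// ler_peMl.
- have s0 : 0 <= rho / b + C * phi M by rewrite addr_ge0 ?divr_ge0 ?mulr_ge0// ltW.
  rewrite bp -powRM ?(ltW b0)//.
  have -> : b * (rho / b + C * phi M) = rho + C * (b * phi M).
    by field; rewrite gt_eqF.
  have le1 : rho + C * (b * phi M) <= rho * (1 + C).
    by rewrite mulrDr mulr1 lerD2l mulrC ler_wpM2r.
  have ge0 : 0 < rho * (1 + C) by rewrite mulr_gt0.
  apply: le_trans rhoCo; apply: le_trans (ge1r_powR _ (ltW p1)); last by rewrite ge0.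
  by apply: powR_mono => //; [exact: ltW|rewrite addr_ge0 ?mulr_ge0// ltW].
Unshelve. all: by end_near. Qed.

Section gentle_gain.
Context (R : realType) (p : R) (hp : 1 < p) (p2 : p <= 2).
Context (X : normedModType R).
Local Notation mu := (@unit_lebesgue R).
Local Notation L := (Lp01 hp).

Let muoo : (mu setT < +oo)%E.
Proof. by rewrite unit_lebesgueT ltry. Qed.

(** Apply [powR_le_sqr] with s = 1/4: since 4^(-p) is at most half of 2^(-p),
    the constant term absorbs only half of the p-th power of the norm of w. *)
Lemma Lp_sqr_ge_norm (B : set (lebesgueType R)) (w : L) : measurable B ->
  ebounded mu (Lp_fun w) -> supported_in B w ->
  2^-1 * fine (mu B) `^ p^-1 <= `|w| -> fine (mu B) / 32 <= Lp_sqr w.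
Proof.
move=> mB wb wB wge; set m := fine (mu B) in wge *.
have p0 : 0 < p by exact: lt_trans hp.
have m0 : 0 <= m by exact: fine_ge0.
have h1 : 2^-1 `^ p * m <= `|w| `^ p.
  have -> : m = (m `^ p^-1) `^ p by rewrite -powRrM mulVf ?gt_eqF// powRr1.
  rewrite -powRM ?invr_ge0 ?powR_ge0//; apply: powR_mono => //; first exact: ltW.
  by rewrite mulr_ge0 ?invr_ge0 ?powR_ge0.
have h2 : `|w| `^ p <= 4^-1 `^ p * m + 4^-1 `^ (p - 2) * Lp_sqr w.
  rewrite Lp_norm_powR -Rintegral_indicZ// -RintegralZl//; last exact: Lp_sqr_integrable.
  have i1 := integrable_indicZ muoo (4^-1 `^ p) mB.
  have i2 := integrableZl measurableT (4^-1 `^ (p - 2)) (Lp_sqr_integrable muoo wb).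
  rewrite -RintegralD//.
  apply: ae_le_Rintegral; [exact: Lp_fun_powR_integrable|exact: integrableD i1 i2|].
  apply: filterS wB => t wt; rewrite indicE.
  have [tB|tB] := boolP (t \in B).
    rewrite mulr1 -(real_normK (num_real (Lp_fun w t))).
    by apply: powR_le_sqr => //; rewrite (ltW p0).
  rewrite wt; last by move=> /mem_set; apply/negP.
  by rewrite normr0 powR0 ?gt_eqF// expr0n !mulr0 addr0.
have e4 : 4^-1 = 2^-1 * 2^-1 :> R by field.
have e1 : 4^-1 `^ p = 2^-1 `^ p * 2^-1 `^ p :> R by rewrite e4 powRM.
have e2 : 4^-1 `^ (p - 2) <= 4 :> R.
  rewrite -[leRHS]invrK -[leRHS]powR_inv1 ?invr_ge0// ger_powR//; have := hp; lra.
have a4 : 4^-1 <= 2^-1 `^ p :> R.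
  rewrite e4 -expr2 -powR_mulrn// ger_powR//; have := hp; lra.
have a2 : 2^-1 `^ p <= 2^-1 :> R.
  by rewrite -[leRHS]powRr1// ger_powR//; [lra|exact: ltW].
have Q0 : 0 <= Lp_sqr w by apply: Rintegral_ge0 => t _; exact: sqr_ge0.
move: h1 h2; rewrite e1 -mulrA => /le_trans h /h {h}.
have := ler_wpM2r Q0 e2.
have am0 : 0 <= 2^-1 `^ p * m by rewrite mulr_ge0 ?powR_ge0.
have := ler_wpM2r am0 a2; have := ler_wpM2r m0 a4; lra.
Qed.

(** The function z is a multiple of the truncation y^M of a function y with S y
    almost 0, so S z is controlled by the tail y - y^M. Both K |S z|^p and
    K (int z)^2 are made at most a quarter of the lower bound
    (delta / M)^2 mu(B) / 32 for int z^2: the first by the choice of M, the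
    second by that of theta. *)
Lemma gentle_gain (S : {linear L -> X}) (K delta : R) :
  bounded_operator S -> gentle_narrow S -> 0 < K -> 0 < delta <= 1 ->
  exists c theta : R, [/\ 0 < c, 0 < theta &
    forall B, unit_measurable B -> 0 < fine (mu B) <= theta -> exists z : L,
      (\forall t \ae mu, `|Lp_fun z t| <= delta * \1_B t) /\
      c * fine (mu B) <= energy K S z].
Proof.
move=> [C0 bS] [phi gphi gS] K0 /andP[delta0 delta1].
pose C := `|C0|; have Cge0 : 0 <= C by exact: normr_ge0.
have Sle u : `|S u| <= C * `|u|.
  by rewrite (le_trans (bS u))// ler_wpM2r// ler_norm.
have p0 : 0 < p by exact: lt_trans hp.
have omega0 : 0 < delta / (128 * K) by rewrite divr_gt0// mulr_gt0.
have [M [kappa [M1 kappa0 /andP[phi0 phi2] small]]] :=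
  gentle_choice hp p2 gphi (normr_ge0 C0) omega0.
have M0 : 0 < M by exact: lt_le_trans M1.
pose a := delta / M.
have a0 : 0 < a by rewrite divr_gt0.
exists (a ^+ 2 / 64), ((128 * K * M ^+ 2)^-1); split.
- by rewrite divr_gt0// exprn_gt0.
- by rewrite invr_gt0 !mulr_gt0// exprn_gt0.
move=> B uB /andP[m0 mtheta]; set m := fine (mu B) in m0 mtheta *.
have mB : measurable B by exact: uB.1.
have kb0 : 0 < kappa * m `^ p^-1 by rewrite mulr_gt0// powR_gt0.
have [y [yB ynorm ytr Sy]] := gS _ _ _ kb0 M0 uB.
have mtr : measurable_fun setT (truncation M (Lp_fun y)).
  by apply: measurable_truncation (measurable_Lp_fun y); exact: ltW.
have [w wE] := Lp_of_bounded (ge1_EFin hp) muoo mtr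
  (fun t => truncation_bound (Lp_fun y) t (ltW M0)).
have wB : supported_in B w.
  by apply: filterS2 wE yB => t -> yt nBt; rewrite truncation0 ?ltW// yt.
have wM : \forall t \ae mu, `|Lp_fun w t| <= M * \1_B t.
  apply: filterS2 wB wE => t w0 wt; rewrite indicE.
  have [tB|tB] := boolP (t \in B); first by rewrite mulr1 wt truncation_bound// ltW.
  by rewrite w0 ?normr0 ?mulr0// => /mem_set; apply/negP.
have wb : ebounded mu (Lp_fun w) by exact: ebounded_indic wM.
have ywle : `|y - w| <= phi M * m `^ p^-1.
  apply: Lp_norm_le_Lnorm ytr; first by apply: measurable_funB => //; exact: measurable_Lp_fun.
  by apply: filterS2 (Lp_funB y w) wE => t -> ->.
have wge : 2^-1 * m `^ p^-1 <= `|w|.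
  have h1 : `|y - w| <= 2^-1 * m `^ p^-1.
    exact: le_trans ywle (ler_wpM2r (powR_ge0 m p^-1) phi2).
  have h2 : m `^ p^-1 <= `|y - w| + `|w|.
    by rewrite /m -ynorm -[X in `|X| <= _](subrK w) ler_normD.
  by move: h1 h2; clear; lra.
have Qw := Lp_sqr_ge_norm mB wb wB wge.
have Sw : `|S w| `^ p <= (kappa + C * phi M) `^ p * m.
  have -> : m = (m `^ p^-1) `^ p by rewrite -powRrM mulVf ?gt_eqF// powRr1// ltW.
  rewrite -powRM ?powR_ge0//; last by rewrite addr_ge0 ?(ltW kappa0)// mulr_ge0.
  apply: powR_mono => //; first exact: ltW.
  rewrite -[w](subKr y).
  rewrite raddfB mulrDl (le_trans (ler_normB _ _))// lerD//.
  by rewrite (le_trans (Sle _))// -mulrA ler_wpM2l.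
exists (a *: w).
have zM : \forall t \ae mu, `|Lp_fun (a *: w) t| <= delta * \1_B t.
  apply: filterS2 (Lp_funZ a w) wM => t -> wt.
  rewrite normrM gtr0_norm// (le_trans (ler_wpM2l (ltW a0) wt))//.
  by rewrite mulrA divfK ?gt_eqF.
split=> //.
have mp : 0 < a ^+ 2 by exact: exprn_gt0.
have loss1 : K * `|S (a *: w)| `^ p <= a ^+ 2 * m / 128.
  rewrite linearZ/= normrZ gtr0_norm// powRM ?(ltW a0)//.
  apply: (@le_trans _ _ (K * (a `^ p * ((kappa + C * phi M) `^ p * m)))).
    by rewrite ler_pM2l// ler_wpM2l ?powR_ge0.
  (* the exponent p is traded for the exponent 2 of the gain *)
  have -> : a `^ p = a ^+ 2 * (delta `^ (p - 2) * M `^ (2 - p)).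
    have -> : 2 - p = (-1) * (p - 2) by ring.
    rewrite powRrM powR_inv1 ?(ltW M0)// -powRM ?ltW ?invr_gt0//.
    rewrite -/a -powR_mulrn ?(ltW a0)// -powRD; first by rewrite addrC subrK.
    by rewrite (gt_eqF a0) implybT.
  have d1 : delta `^ (p - 2) <= delta^-1.
    by rewrite -[leRHS]powR_inv1 ?(ltW delta0)// ger_powR ?delta0//; have := hp; lra.
  have := ler_pM (powR_ge0 _ _) (mulr_ge0 (powR_ge0 _ _) (powR_ge0 _ _)) d1 small.
  have -> : delta^-1 * (delta / (128 * K)) = (128 * K)^-1.
    by field; rewrite !gt_eqF.
  move=> le1; have := ler_wpM2l (ltW (mulr_gt0 K0 (mulr_gt0 mp m0))) le1.
  have -> : K * (a ^+ 2 * m) / (128 * K) = a ^+ 2 * m / 128.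
    by field; rewrite gt_eqF.
  by apply: le_trans; rewrite le_eqVlt; apply/orP; left; apply/eqP; ring.
have loss2 : K * Lp_int (a *: w) ^+ 2 <= a ^+ 2 * m / 128.
  have zb : ebounded mu (Lp_fun (a *: w)) by exact: ebounded_indic zM.
  have intz : `|Lp_int (a *: w)| <= delta * m.
    rewrite -Rintegral_indicZ//.
    apply: le_trans (le_normr_Rintegral measurableT (Lp_fun_integrable muoo zb)) _.
    apply: ae_le_Rintegral zM; last exact: integrable_indicZ.
    exact: integrable_norm (Lp_fun_integrable muoo zb).
  have : Lp_int (a *: w) ^+ 2 <= (delta * m) ^+ 2.
    by rewrite -(real_normK (num_real (Lp_int _))) ler_pXn2r ?nnegrE// mulr_ge0// ltW.
  move=> /(ler_wpM2l (ltW K0)) /le_trans; apply.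
  have -> : K * (delta * m) ^+ 2 = K * delta ^+ 2 * m * m by ring.
  have Kdm : 0 <= K * delta ^+ 2 * m by rewrite !mulr_ge0 ?sqr_ge0 ?ltW.
  apply: le_trans (ler_wpM2l Kdm mtheta) _.
  rewrite le_eqVlt; apply/orP; left; apply/eqP; rewrite /a; field.
  by rewrite !gt_eqF.
rewrite /energy Lp_sqrZ// mulrDr.
have := ler_wpM2l (ltW mp) Qw; rewrite -/m.
move: loss1 loss2; clear; lra.
Qed.

End gentle_gain.

(** * From near-maximisers to signs *)

Section signs.
Context d (T : measurableType d) (R : realType).
Context (mu : {measure set T -> \bar R}) (p : R) (p1 : (1 <= p%:E)%E).
Context (muoo : (mu setT < +oo)%E).
Local Notation L := (Lp mu p1).
Implicit Types (A B : set T) (x s : L).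

Lemma sqr_indic_norm (r : R) A t : r ^+ 2 = \1_A t -> `|r| = \1_A t.
Proof.
rewrite indicE -(real_normK (num_real r)); case: (t \in A) => /= /eqP.
  by rewrite sqrf_eq1 => /predU1P[//|/eqP r1]; have := normr_ge0 r; rewrite r1 lerNr oppr0 ler10.
by rewrite sqrf_eq0 => /eqP.
Qed.

(** On A the distance from x(t) to its sign is 1 - |x(t)|, less than delta
    off the exceptional set and at most 1 on it. Being at most 1 it
    dominates its p-th power, so one estimate serves both conclusions. *)
Lemma round_to_sign A x (delta : R) : measurable A -> 0 <= delta ->
  (\forall t \ae mu, `|Lp_fun x t| <= \1_A t) ->
  exists s, [/\ \forall t \ae mu, Lp_fun s t ^+ 2 = \1_A t,
    `|s - x| `^ p <= delta * fine (mu A) +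
      fine (mu (A `&` [set t | `|Lp_fun x t| <= 1 - delta])) &
    `|Lp_int s - Lp_int x| <= delta * fine (mu A) +
      fine (mu (A `&` [set t | `|Lp_fun x t| <= 1 - delta]))].
Proof.
move=> mA delta0 xA; set G := A `&` _.
have mx : measurable_fun setT (Lp_fun x) by exact: measurable_Lp_fun.
have mG : measurable G.
  apply: measurableI => //.
  have mnx : measurable_fun setT (fun t => `|Lp_fun x t|) by exact: measurableT_comp.
  have := mnx measurableT `]-oo, (1 - delta)]%classic (measurable_itv _).
  by rewrite setTI; congr measurable; apply/seteqP; split => t; rewrite /= in_itv.
pose P : set T := [set t | 0 <= Lp_fun x t].
have mP : measurable P.
  have := mx measurableT `[0, +oo[%classic (measurable_itv _).
  by rewrite setTI; congr measurable; apply/seteqP; split => t; rewrite /= in_itv/= andbT.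
pose f (t : T) : R := \1_A t * (2 * \1_P t - 1).
have mf : measurable_fun setT f.
  apply: measurable_funM => //; apply: measurable_funB => //.
  exact: measurable_funM.
have f1 t : `|f t| <= 1.
  rewrite /f !indicE; case: (t \in A); case: (t \in P);
    rewrite ?mul0r ?normr0// mul1r ?mulr1 ?mulr0 ?sub0r ?normrN1//.
  by rewrite (_ : 2 - 1 = 1) ?normr1//; ring.
have [s sf] := Lp_of_bounded p1 muoo mf f1.
have sbd : ebounded mu (Lp_fun s) by exists 1; apply: filterS sf => t ->.
have xbd : ebounded mu (Lp_fun x).
  by apply: (@ebounded_indic _ _ _ _ _ _ A 1); apply: filterS xA => t; rewrite mul1r.
have sxbd := ebounded_Lp_funD sbd (ebounded_Lp_funN xbd).
pose h (t : T) : R := delta * \1_A t + 1 * \1_G t.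
have ih : mu.-integrable setT (EFin \o h).
  have iA := integrable_indicZ muoo delta mA.
  exact: (integrableD measurableT iA (integrable_indicZ muoo 1 mG)).
have intE : \int[mu]_t h t = delta * fine (mu A) + fine (mu G).
  rewrite RintegralD//; [|exact: integrable_indicZ..].
  by rewrite !Rintegral_indicZ// mul1r.
have key : \forall t \ae mu, `|Lp_fun (s - x) t| <= Num.min 1 (h t).
  apply: filterS3 (Lp_funB s x) sf xA => t -> ->.
  rewrite /f /h !indicE.
  have [tA|tA] := boolP (t \in A); last first.
    rewrite /= normr_le0 => /eqP ->; rewrite mul0r subrr normr0 le_min ler01 mulr0 mul1r add0r.
    by rewrite ler0n.
  rewrite /= mulr1n !mul1r mulr1 => xt.
  have -> : `|2 * (t \in P)%:R - 1 - Lp_fun x t| = 1 - `|Lp_fun x t|.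
    have [tP|tP] := boolP (t \in P).
      have x0 : 0 <= Lp_fun x t := set_mem tP.
      move: xt; rewrite ger0_norm// mulr1 => xt.
      rewrite ger0_norm; first by ring.
      by rewrite (_ : 2 - 1 = 1) ?subr_ge0//; ring.
    have x0 : Lp_fun x t < 0.
      by rewrite ltNge; apply: contra tP => x0; exact: mem_set.
    move: xt; rewrite ltr0_norm// mulr0 sub0r => xt.
    by rewrite ler0_norm; [ring|lra].
  rewrite le_min gerBl normr_ge0/=.
  have [xs|xs] := leP `|Lp_fun x t| (1 - delta).
    rewrite [t \in G]mem_set; last by split; [exact: set_mem|].
    by rewrite /= mulr1n; have := normr_ge0 (Lp_fun x t); lra.
  have : 0 <= (t \in G)%:R :> R by rewrite ler0n.
  lra.
exists s; split.
- apply: filterS sf => t ->; rewrite /f !indicE.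
  by case: (t \in A); case: (t \in P); rewrite /=; ring.
- rewrite Lp_norm_powR -intE; apply: ae_le_Rintegral => //.
    exact: Lp_fun_powR_integrable.
  apply: filterS key => t; rewrite le_min => /andP[le1]; apply: le_trans.
  have [->|n0] := eqVneq `|Lp_fun (s - x) t| 0.
    by rewrite powR0// gt_eqF// (lt_le_trans ltr01)// -lee_fin.
  by rewrite ge1r_powR ?le1 ?andbT ?lt_neqAle 1?eq_sym ?n0 ?normr_ge0// -lee_fin.
- rewrite -Lp_intB// -intE.
  apply: le_trans (le_normr_Rintegral measurableT (Lp_fun_integrable muoo sxbd)) _.
  apply: ae_le_Rintegral ih _; first exact: integrable_norm (Lp_fun_integrable muoo sxbd).
  by apply: filterS key => t; rewrite le_min => /andP[].
Qed.

(** If the integral of s is nonnegative, it is at most the measure of the set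
    where s = 1; switching the sign on a subset of measure half the integral
    balances s. *)
Lemma balance_sign A s : p <= 2 -> divisible mu ->
  measurable A -> (\forall t \ae mu, Lp_fun s t ^+ 2 = \1_A t) ->
  exists s', [/\ \forall t \ae mu, Lp_fun s' t ^+ 2 = \1_A t, Lp_int s' = 0 &
    `|s' - s| `^ p <= 2 * `|Lp_int s|].
Proof.
move=> p2 divmu mA.
wlog int0 : s / 0 <= Lp_int s => [hw sA|sA].
  have [int0|int0] := leP 0 (Lp_int s); first exact: hw.
  have sbd : ebounded mu (Lp_fun s).
    apply: (@ebounded_indic _ _ _ _ _ _ A 1); apply: filterS sA => t /sqr_indic_norm ->.
    by rewrite mul1r.
  have intN : Lp_int (- s) = - Lp_int s by rewrite -scaleN1r Lp_intZ// mulN1r.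
  have [||s' [s'A s'0 s's]] := hw (- s).
  - by rewrite intN oppr_ge0 ltW.
  - by apply: filterS2 (Lp_funN s) sA => t ->; rewrite sqrrN.
  have s'bd : ebounded mu (Lp_fun s').
    apply: (@ebounded_indic _ _ _ _ _ _ A 1); apply: filterS s'A => t /sqr_indic_norm ->.
    by rewrite mul1r.
  exists (- s'); split.
  - by apply: filterS2 (Lp_funN s') s'A => t ->; rewrite sqrrN.
  - by rewrite -scaleN1r Lp_intZ// s'0 mulr0.
  - by rewrite -opprD normrN; move: s's; rewrite opprK intN normrN.
have p0 : 0 < p by rewrite (lt_le_trans ltr01)// -lee_fin.
have ms : measurable_fun setT (Lp_fun s) by exact: measurable_Lp_fun.
have sbd : ebounded mu (Lp_fun s).
  apply: (@ebounded_indic _ _ _ _ _ _ A 1); apply: filterS sA => t /sqr_indic_norm ->.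
  by rewrite mul1r.
pose P : set T := [set t | Lp_fun s t = 1].
have mP : measurable P.
  have := ms measurableT [set 1] (measurable_set1 _).
  by rewrite setTI; congr measurable.
have intP : Lp_int s <= fine (mu P).
  rewrite -[leRHS]mul1r -Rintegral_indicZ//; apply: ae_le_Rintegral.
  - exact: Lp_fun_integrable.
  - exact: integrable_indicZ.
  apply: filterS sA => t; rewrite !indicE mul1r => st.
  have [tP|tP] := boolP (t \in P); first by have -> : Lp_fun s t = 1 := set_mem tP.
  move: st; case: (t \in A) => /= /eqP; last by rewrite sqrf_eq0 => /eqP ->.
  rewrite sqrf_eq1 => /predU1P[s1|/eqP ->]; last by rewrite oppr_le0.
  by move: tP; rewrite mem_set.
have [|B [mB BP muB]] := divmu P (Lp_int s / 2) mP.
  by rewrite divr_ge0//= (le_trans _ intP)// ler_pdivrMr// ler_peMr// ler1n.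
have mg : measurable_fun setT (fun t => 2 * \1_B t : R) by exact: measurable_funM.
have g2 t : `|2 * \1_B t| <= 2 :> R.
  by rewrite indicE; case: (t \in B); rewrite ?mulr1 ?mulr0 ?normr0// ger0_norm.
have [u uB] := Lp_of_bounded p1 muoo mg g2.
have ubd : ebounded mu (Lp_fun u) by exists 2; apply: filterS uB => t ->.
exists (s - u); split.
- apply: filterS3 (Lp_funB s u) uB sA => t -> -> <-; rewrite indicE.
  have [tB|tB] := boolP (t \in B); last by rewrite mulr0 subr0.
  by rewrite (BP _ (set_mem tB)) /= mulr1n; ring.
- rewrite Lp_intB// /Lp_int (ae_eq_Rintegral (measurable_Lp_fun u) mg uB).
  by rewrite Rintegral_indicZ// muB/= mulrC divfK// subrr.
rewrite addrAC subrr add0r normrN Lp_norm_powR ger0_norm//.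
have -> : 2 * Lp_int s = 2 ^+ 2 * fine (mu B) by rewrite muB/=; field.
rewrite -Rintegral_indicZ//; apply: ae_le_Rintegral.
- exact: Lp_fun_powR_integrable.
- exact: integrable_indicZ.
apply: filterS uB => t ->; rewrite indicE.
case: (t \in B); last by rewrite !mulr0 normr0 powR0 ?gt_eqF.
by rewrite !mulr1 ger0_norm// -powR_mulrn// ler_powR// ler1n.
Qed.

End signs.

(** * Gentle-narrow operators are narrow *)

(** The energy argument sees the target space through its type p inequality,
    which for p <= 2 the space L_p itself satisfies. *)
Lemma gentle_narrow_narrow (R : realType) (p : R) (hp : 1 < p)
    (X : normedModType R) (S : {linear Lp01 hp -> X}) : p <= 2 ->
  power_parallelogram p X -> bounded_operator S -> gentle_narrow S -> narrow S.
Proof.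
move=> p2 typeX bS gS e A e0 [mA A01].
have p0 : 0 < p by exact: (lt_trans ltr01 hp).
pose mu := @unit_lebesgue R.
have muoo : (@unit_lebesgue R setT < +oo)%E by rewrite unit_lebesgueT ltry.
have muA1 : fine (mu A) <= 1.
  by rewrite -lee_fin fineK ?unit_lebesgue_fin_num// unit_lebesgue_le1.
have [C0 SC0] := bS; pose C := `|C0|; have Cge0 : 0 <= C by exact: normr_ge0.
have Sle u : `|S u| <= C * `|u|.
  by rewrite (le_trans (SC0 u))// ler_wpM2r// ler_norm.
have C9 : 0 < 1 + 9 * C by rewrite ltr_wpDr// mulr_ge0.
(* S x, S (s - x) and S (s' - s) have norms at most rho, 2 C rho and 6 C rho *)
pose rho := Num.min 1 (e / (1 + 9 * C) / 2).
have rho0 : 0 < rho by rewrite lt_min ltr01 !divr_gt0.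
have rho1 : rho <= 1 by rewrite ge_min lexx.
have rhoe : rho * (1 + 9 * C) < e.
  rewrite -ltr_pdivlMr// (le_lt_trans (_ : _ <= e / (1 + 9 * C) / 2))//.
    by rewrite ge_min lexx orbT.
  by rewrite ltr_pdivrMr// ltr_pMr ?divr_gt0// ltr1n.
pose eta := rho `^ p.
have eta0 : 0 < eta by exact: powR_gt0.
have eta1 : eta <= 1.
  rewrite (le_trans _ rho1)// /eta; apply: ge1r_powR (ltW hp).
  by rewrite rho0.
have root (n : nat) (a : R) : (0 < n)%N -> 0 <= a ->
    a `^ p <= n%:R * eta -> a <= n%:R * rho.
  move=> n0 a0 an; apply: (@powR_mono_inv _ p) => //.
    by rewrite mulr_ge0// ltW.
  apply: (le_trans an); rewrite powRM ?(ltW rho0)// (ler_pM2r eta0).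
  by rewrite le1r_powR ?ler1n ?(ltW hp).
(* for a near-maximiser K (|S x|^p + (int x)^2) is at most 2, so with this K
   the p-th power of |S x| is at most eta^2 <= rho^p, and |int x| <= eta *)
pose K := 2 / eta ^+ 2.
have K0 : 0 < K by rewrite divr_gt0// exprn_gt0.
have deltaP : 0 < eta <= 1 by rewrite eta0.
have [c [theta [c0 theta0 gain]]] := gentle_gain p2 bS gS K0 deltaP.
have gainA : exists c theta : R, [/\ 0 < c, 0 < theta & forall B, measurable B ->
    B `<=` A -> 0 < fine (mu B) <= theta -> exists z : Lp01 hp,
      (\forall t \ae mu, `|Lp_fun z t| <= eta * \1_B t) /\
      c * fine (mu B) <= energy K S z].
  exists c, theta; split=> // B mB BA; apply: gain; split=> //.
  exact: subset_trans A01.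
have [x [xA xK xG]] :=
  near_maximizer muoo typeX (@unit_lebesgue_divisible R) gainA mA (ltW K0) eta0.
have {xK} xK : `|S x| `^ p + Lp_int x ^+ 2 <= eta ^+ 2.
  have : K * (`|S x| `^ p + Lp_int x ^+ 2) <= 2.
    by rewrite (le_trans xK)// (_ : 2 = 1 + 1)// lerD2r.
  rewrite -ler_pdivlMl// => /le_trans; apply.
  by rewrite /K invf_div divfK.
have Sx : `|S x| <= 1%:R * rho.
  apply: root => //; rewrite mul1r (le_trans _ (_ : eta ^+ 2 <= eta))//.
    by rewrite (le_trans _ xK)// lerDl sqr_ge0.
  by rewrite expr2 ler_piMl// ltW.
have Ix : `|Lp_int x| <= eta.
  rewrite -(@ler_pXn2r _ 2) ?nnegrE ?(ltW eta0)// real_normK ?num_real//.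
  by rewrite (le_trans _ xK)// lerDr powR_ge0.
have [s [sA sx Is]] := round_to_sign muoo mA (ltW eta0) xA.
have le2 : eta * fine (mu A) + fine (mu (A `&` [set t | `|Lp_fun x t| <= 1 - eta]))
    <= 2%:R * eta.
  rewrite (_ : 2 * eta = eta * 1 + eta); last by ring.
  by rewrite lerD// ler_wpM2l// ltW.
have {}sx : `|s - x| <= 2%:R * rho by apply: root => //; exact: le_trans le2.
have {}Is : `|Lp_int s| <= 3 * eta.
  have := le_trans Is le2; have := ler_normD (Lp_int s - Lp_int x) (Lp_int x).
  by rewrite subrK; move: Ix; clear; lra.
have [s' [s'A Is' s's]] := balance_sign muoo p2 (@unit_lebesgue_divisible R) mA sA.
have {}s's : `|s' - s| <= 6%:R * rho.
  apply: root => //; apply: (le_trans s's).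
  by move: Is; clear; lra.
exists s'; split=> //.
  have s'bd : ebounded mu (Lp_fun s').
    exists 1; apply: filterS s'A => t /sqr_indic_norm ->.
    by rewrite indicE; case: (t \in A).
  have fin := integrable_fin_num measurableT (Lp_fun_integrable muoo s'bd).
  by rewrite -[LHS](fineK fin) -[fine _]/(Lp_int s') Is'.
have -> : s' = x + (s - x) + (s' - s) by rewrite [x + _]addrC subrK addrC subrK.
rewrite 2!raddfD (le_lt_trans _ rhoe)//.
have S1 : `|S (s - x)| <= C * (2 * rho).
  by rewrite (le_trans (Sle _))// ler_wpM2l.
have S2 : `|S (s' - s)| <= C * (6 * rho).
  by rewrite (le_trans (Sle _))// ler_wpM2l.
apply: (le_trans (ler_normD _ _)); apply: (le_trans (lerD (ler_normD _ _) (lexx _))).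
have Cr0 : 0 <= C * rho by rewrite mulr_ge0// ltW.
by move: Sx S1 S2 Cr0; clear; lra.
Qed.

Theorem theoremC (R : realType) (p : R) (hp : 1 < p) (hp2 : p <= 2)
    (T : {linear Lp01 hp -> Lp01 hp}) :
  bounded_operator T -> gentle_narrow T -> narrow T.
Proof.
by apply: gentle_narrow_narrow => //; exact: Lp_norm_parallelogram_le.
Qed.
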